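(* Let $I\subset\mathbf{R}$ be an interval with nonempty interior and let $F$ be admissible on $I$. (a) Let $\Omega$ be a convex domain in $\mathbf{R}^N$ with $\Omega\neq\mathbf{R}^N$. Then $F$-concavity is nontrivial in $\Omega$. (b) $F$-concavity is trivial in $\mathbf{R}^N$ if and only if $\inf_I F>-\infty$. Furthermore, if $F$-concavity is nontrivial in $\mathbf{R}^N$ and $f$ is a nonconstant $F$-concave function in $\mathbf{R}^N$, then $\inf_{x\in\mathbf{R}^N}F(f(x))=-\infty$.
   Context: A convex domain is a nonempty open convex set in $\mathbf{R}^N$, $N\ge 1$. A function $F:I\to\mathbf{R}\cup\{-\infty\}$ is called admissible on $I$ if $F$ is strictly increasing on $I$ and $F$ is continuous on the interior $\mathrm{Int}\,I$ (so $F$ can take the value $-\infty$ only at a left endpoint belonging to $I$). Let $\mathcal{A}_\Omega(I)$ be the set of functions $f$ on $\Omega$ with $f(x)\in I$ for all $x\in\Omega$. A function $f\in\mathcal{A}_\Omega(I)$ is called $F$-concave in $\Omega$ if $F(f((1-\mu)x+\mu y))\ge(1-\mu)F(f(x))+\mu F(f(y))$ for all $x,y\in\Omega$ and $\mu\in[0,1]$ (with the usual conventions for $-\infty$; for $\mu\in\{0,1\}$ the inequality is regarded as trivially true). $\mathcal{C}_\Omega[F]$ denotes the set of $F$-concave functions in $\Omega$. $F$-concavity is called trivial in $\Omega$ if $\mathcal{C}_\Omega[F]$ equals the set of constant functions in $\mathcal{A}_\Omega(I)$, and nontrivial otherwise. *)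

(* Defs.v *)
From HB Require Import structures.
From mathcomp Require Export all_boot all_order all_algebra.
From mathcomp Require Export all_classical all_reals all_analysis.

Set Implicit Arguments.
Unset Strict Implicit.
Unset Printing Implicit Defensive.

Import Order.TTheory GRing.Theory Num.Theory.
Import numFieldNormedType.Exports.

Local Open Scope classical_set_scope.
Local Open Scope ring_scope.

Definition convex_domain (R : realType) (N : nat) (Omega : set 'rV[R]_N) : Prop :=
  [/\ Omega !=set0, open Omega & convex_set Omega].

(* F : I -> R u {-oo} is encoded by a total map into \bar R; only its values
   on I matter. *)
Definition admissible (R : realType) (I : set R) (F : R -> \bar R) : Prop :=
  [/\ forall r, I r -> F r != +oo%E,
      forall r s, I r -> I s -> r < s -> (F r < F s)%E
    & forall r, I° r -> {for r, continuous F}].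

(* Functions on Omega are encoded by total functions; every notion below only
   depends on their values on Omega. *)
Definition range_in (R : realType) (N : nat) (Omega : set 'rV[R]_N) (I : set R) :
    set ('rV[R]_N -> R) :=
  [set f | forall x, Omega x -> I (f x)].

(* With the library convention 0 * -oo = 0, the right-hand side is F (f x) for
   mu = 0 and F (f y) for mu = 1, so these two cases hold trivially. *)
Definition F_concave (R : realType) (N : nat) (Omega : set 'rV[R]_N)
    (I : set R) (F : R -> \bar R) : set ('rV[R]_N -> R) :=
  [set f | range_in Omega I f /\
    forall x y (mu : R), Omega x -> Omega y -> 0 <= mu <= 1 ->
      ((1 - mu)%:E * F (f x) + mu%:E * F (f y)
         <= F (f ((1 - mu) *: x + mu *: y)%R))%E].

Definition constant_on (R : realType) (N : nat) (Omega : set 'rV[R]_N) :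
    set ('rV[R]_N -> R) :=
  [set f | exists c, forall x, Omega x -> f x = c].

Definition F_concavity_trivial (R : realType) (N : nat) (Omega : set 'rV[R]_N)
    (I : set R) (F : R -> \bar R) : Prop :=
  F_concave Omega I F = range_in Omega I `&` constant_on Omega.

Definition F_concavity_nontrivial (R : realType) (N : nat)
    (Omega : set 'rV[R]_N) (I : set R) (F : R -> \bar R) : Prop :=
  ~ F_concavity_trivial Omega I F.

(* Main.v *)
(** Composing with [F^-1] turns every concave function with values in [F(I)]
    into an [F]-concave function. On a convex domain other than the whole space
    the distance to the complement is concave, positive, finite and nonconstant,
    so a truncated and rescaled copy of it fits into any compact subinterval of
    [F(Int I)]. On the whole space a concave function bounded below is constant,
    because along any line its graph lies above chords to arbitrarily far
    points. If [inf F = -oo], a nonconstant example is [F^-1 (b - |x|)] when [F]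
    is finite, and a two-valued function, equal to the point where [F = -oo]
    off the origin, otherwise. *)

Require Import Defs.
From mathcomp Require Import ring lra.
Set Implicit Arguments.
Unset Strict Implicit.
Unset Printing Implicit Defensive.

Import Order.TTheory GRing.Theory Num.Theory.
Import numFieldNormedType.Exports.

Local Open Scope classical_set_scope.
Local Open Scope ring_scope.

(** * Concave functions on normed spaces and the inradius of a set *)

Section ConcaveFunctions.
Context {R : realType} {V : normedModType R}.
Implicit Types (Omega : set V) (g : V -> R).

Definition concave_on Omega g := forall x y (mu : R),
  Omega x -> Omega y -> 0 <= mu <= 1 ->
  (1 - mu) * g x + mu * g y <= g ((1 - mu) *: x + mu *: y).

(** The minimum of two concave functions is concave, and the constant [c] is one of them. This
    truncates and rescales a concave function so that it fits into a prescribed interval. *)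
Lemma concave_on_min_affine Omega g (a b c : R) : 0 <= b ->
  concave_on Omega g -> concave_on Omega (fun x => a + b * Num.min (g x) c).
Proof.
move=> b0 cg x y mu Ox Oy /[dup] mu01 /andP[mu0 mu1].
have := cg x y mu Ox Oy mu01; set z := (1 - mu) *: x + mu *: y => gz.
suff : (1 - mu) * Num.min (g x) c + mu * Num.min (g y) c <= Num.min (g z) c.
  by move=> /(ler_wpM2l b0); lra.
have xg : Num.min (g x) c <= g x by rewrite ge_min lexx.
have yg : Num.min (g y) c <= g y by rewrite ge_min lexx.
have xc : Num.min (g x) c <= c by rewrite ge_min lexx orbT.
have yc : Num.min (g y) c <= c by rewrite ge_min lexx orbT.
have mu1' : 0 <= 1 - mu by lra.
rewrite le_min; apply/andP; split.
  by apply: le_trans gz; apply: lerD; apply: ler_wpM2l.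
rewrite [leRHS](_ : c = (1 - mu) * c + mu * c); last by ring.
by apply: lerD; apply: ler_wpM2l.
Qed.

Lemma concave_on_opp_norm Omega (b : R) : concave_on Omega (fun x => b - `|x|).
Proof.
move=> x y mu _ _ /andP[mu0 mu1].
have := ler_normD ((1 - mu) *: x) (mu *: y).
rewrite !normrZ (ger0_norm mu0) ger0_norm ?subr_ge0//; lra.
Qed.

(* The radius [0] is always allowed since its open ball is empty. *)
Definition inradius Omega (x : V) : R :=
  sup [set r | 0 <= r /\ ball x r `<=` Omega].

Lemma has_sup_inradius Omega x : Omega <> setT ->
  has_sup [set r | 0 <= r /\ ball x r `<=` Omega].
Proof.
move=> OT; split.
  by exists 0; split=> // y; rewrite -ball_normE /= normr_lt0.
have [y Oy] : exists y, ~ Omega y.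
  by apply/existsNP => allO; apply: OT; apply/seteqP; split.
exists `|x - y| => r [_ xrO]; rewrite leNgt; apply/negP => ry.
by apply: Oy; apply: xrO; rewrite -ball_normE.
Qed.

Lemma inradius_ge0 Omega x : Omega <> setT -> 0 <= inradius Omega x.
Proof.
move=> OT; have [_ hu] := has_sup_inradius x OT.
by apply: (ub_le_sup hu); split=> // y; rewrite -ball_normE /= normr_lt0.
Qed.

Lemma inradius_gt0 Omega x : Omega <> setT -> open Omega -> Omega x ->
  0 < inradius Omega x.
Proof.
move=> OT oO Ox; have [_ hu] := has_sup_inradius x OT.
have := open_nbhs_nbhs (conj oO Ox) => /nbhs_ballP[e /= e0 xeO].
by apply: (lt_le_trans e0); apply: (ub_le_sup hu); split=> //; exact: ltW.
Qed.

(** Balls are open, so a point closer to [x] than the supremum already lies in a ball of some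
    allowed radius. *)
Lemma ball_inradius Omega x : Omega <> setT ->
  ball x (inradius Omega x) `<=` Omega.
Proof.
move=> OT y; rewrite -ball_normE /= => xy.
have [S0 _] := has_sup_inradius x OT.
have [r [_ xrO] yr] := sup_gt S0 xy.
by apply: xrO; rewrite -ball_normE.
Qed.

Lemma convex_setP Omega x y (mu : R) : convex_set Omega ->
  Omega x -> Omega y -> 0 <= mu <= 1 -> Omega ((1 - mu) *: x + mu *: y).
Proof.
move=> cO Ox Oy /andP[mu0 mu1].
(* In [convex_set] the weight multiplies the first point, hence the order [y], [x]. *)
have := cO y x (Itv01 mu0 mu1) (mem_set Oy) (mem_set Ox) => /set_mem.
by rewrite [X in Omega X -> _]addrC.
Qed.

(** With [c] the new centre and [t] the new radius, a point of the ball is [c + t *: w] with [w] of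
    norm less than 1. It is the same convex combination of [x + r *: w] and [y + s *: w], which both
    lie in [Omega]. *)
Lemma ball_convex_comb Omega x y (r s mu : R) : convex_set Omega ->
  0 <= r -> 0 <= s -> 0 <= mu <= 1 -> Omega x -> Omega y ->
  ball x r `<=` Omega -> ball y s `<=` Omega ->
  ball ((1 - mu) *: x + mu *: y) ((1 - mu) * r + mu * s) `<=` Omega.
Proof.
move=> cO r0 s0 mu01 Ox Oy xO yO z.
set c := _ + _; set t := _ + _; rewrite -ball_normE /= => czt.
have t0 : 0 < t by apply: le_lt_trans czt.
pose w := t^-1 *: (z - c).
have w1 : `|w| < 1.
  by rewrite normrZ gtr0_norm ?invr_gt0// ltr_pdivrMl// mulr1 distrC.
have tw : t *: w = z - c by rewrite scalerA divff ?gt_eqF// scale1r.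
clearbody w; have in_ball u q : 0 <= q -> Omega u -> ball u q `<=` Omega ->
    Omega (u + q *: w).
  (* For [q = 0] the ball is empty and gives nothing, but the point is then [u] itself. *)
  rewrite le_eqVlt => /orP[/eqP <- Ou _|q0 _ uO]; first by rewrite scale0r addr0.
  apply: uO; rewrite -ball_normE /= opprD addrA subrr sub0r.
  by rewrite normrN normrZ gtr0_norm// gtr_pMr.
have <- : (1 - mu) *: (x + r *: w) + mu *: (y + s *: w) = z.
  rewrite !scalerDr !scalerA addrACA -scalerDl -/c -/t tw.
  by rewrite addrC subrK.
by apply: convex_setP => //; exact: in_ball.
Qed.

(** Radii allowed at [x] and [y] combine into a radius allowed at the convex combination; taking
    them within [e] of the suprema loses at most [e]. *)
Lemma inradius_concave Omega : Omega <> setT -> convex_set Omega ->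
  concave_on Omega (inradius Omega).
Proof.
move=> OT cO x y mu Ox Oy /[dup] mu01 /andP[mu0 mu1].
apply/ler_addgt0Pr => e e0.
have [r [r0 xrO] xr] := sup_adherent e0 (has_sup_inradius x OT).
have [s [s0 ysO] ys] := sup_adherent e0 (has_sup_inradius y OT).
have [_ hu] := has_sup_inradius ((1 - mu) *: x + mu *: y) OT.
have mu1' : 0 <= 1 - mu by rewrite subr_ge0.
have : (1 - mu) * r + mu * s <= inradius Omega ((1 - mu) *: x + mu *: y).
  apply: (ub_le_sup hu); split; first by rewrite addr_ge0 ?mulr_ge0.
  exact: ball_convex_comb.
have := ler_wpM2l mu1' (ltW xr); have := ler_wpM2l mu0 (ltW ys).
rewrite -/(inradius Omega x) -/(inradius Omega y).
move: (inradius _ _) (inradius _ _) (inradius _ _) => a b c; lra.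
Qed.

(* If the inradius were constant, unions of balls of that radius would exhaust
   the whole space. *)
Lemma inradius_nonconstant Omega : Omega !=set0 -> open Omega ->
  Omega <> setT ->
  exists x y, [/\ Omega x, Omega y & inradius Omega x < inradius Omega y].
Proof.
move=> [x Ox] oO OT; apply: contrapT => noxy.
have const u : Omega u -> inradius Omega u = inradius Omega x.
  move=> Ou; apply/eqP; rewrite eq_le !leNgt; apply/andP; split; apply/negP => h.
    by apply: noxy; exists x, u.
  by apply: noxy; exists u, x.
apply: (OT); apply/seteqP; split=> // y _.
have rho0 : 0 < inradius Omega x by exact: inradius_gt0.
set rho := inradius Omega x in const rho0.
(* So many steps that each has length less than [rho]: starting at [x], every step stays inside a
   ball contained in [Omega], and the last one reaches [y]. *)
pose n := (Num.trunc (`|y - x| / rho)).+1.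
have n0 : 0 < n%:R :> R by rewrite ltr0n.
pose v := n%:R^-1 *: (y - x).
have v_lt : `|v| < rho.
  rewrite normrZ gtr0_norm ?invr_gt0// ltr_pdivrMl// -ltr_pdivrMr//.
  exact: truncnS_gt.
have steps k : Omega (x + v *+ k).
  elim: k => [|k Ok]; first by rewrite addr0.
  apply: (@ball_inradius _ (x + v *+ k)) => //; rewrite const// -ball_normE /=.
  by rewrite mulrS addrCA opprD addrA addrAC subrr add0r normrN.
have := steps n; rewrite -scaler_nat scalerA divff ?gt_eqF// scale1r.
by rewrite addrC subrK.
Qed.

(** If [g y < g x], then on the ray from [x] through [y] concavity forces [g] to drop at least
    linearly, hence below [m] at a distant point. *)
Lemma bounded_below_concave_constant g (m : R) : concave_on setT g ->
  (forall x, m <= g x) -> forall x y, g x <= g y.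
Proof.
move=> cg mg x y; rewrite leNgt; apply/negP => yx.
have d0 : 0 < g x - g y by rewrite subr_gt0.
(* Chosen so that [g x - n * (g x - g y) < m]; the left side bounds [g] from above at the point [z]
   below. *)
pose n := (Num.trunc ((g x - m) / (g x - g y))).+1.
have n0 : 0 < n%:R :> R by rewrite ltr0n.
have n1 : 1 <= n%:R :> R by rewrite ler1n.
have : (g x - m) / (g x - g y) < n%:R by exact: truncnS_gt.
rewrite ltr_pdivrMr// => nd.
have mu01 : 0 <= (n%:R^-1 : R) <= 1 by rewrite invr_ge0 ltW//= invf_le1.
pose z := x + n%:R *: (y - x).
have yE : (1 - n%:R^-1) *: x + n%:R^-1 *: z = y.
  rewrite scalerDr scalerA mulVf ?gt_eqF// scale1r addrA -scalerDl subrK.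
  by rewrite scale1r addrC subrK.
have := cg x z n%:R^-1 I I mu01; rewrite yE.
have := mg z; move: (g z) => b mb.
have ip : 0 < (n%:R^-1 : R) by rewrite invr_gt0.
have invn : n%:R^-1 * n%:R = 1 :> R by rewrite mulVf ?gt_eqF.
move: ip invn nd; move: (n%:R^-1 : R) => i ip invn nd h.
move: nd; rewrite -(ltr_pM2l ip) mulrA invn.
have := ler_wpM2l (ltW ip) mb; lra.
Qed.

End ConcaveFunctions.

(** * Admissible functions on an interval *)

Section AdmissibleFunctions.
Context {R : realType} (I : set R) (F : R -> \bar R).
Context (I_interval : is_interval I) (F_adm : admissible I F).

Lemma interval_interior_between (p q r : R) : I p -> I q -> p < r < q -> I° r.
Proof.
move=> Ip Iq prq; rewrite /interior /=.
apply: filterS (near_in_itvoo _ : \near r, r \in `]p, q[); last by rewrite in_itv.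
move=> z; rewrite in_itv /= => /andP[pz zq].
by apply: (I_interval Ip Iq); rewrite !ltW.
Qed.

Lemma interior_between (r : R) : I° r -> exists p q : R, [/\ I° p, I° q & p < r < q].
Proof.
rewrite {1}/interior /= => /nbhs_ballP[e /= e0 reI].
have in_I z : `|z| < e -> I (r + z).
  by move=> ze; apply: reI; rewrite -ball_normE /= opprD addNKr normrN.
have Ip : I (r - 2^-1 * e) by apply: in_I; rewrite normrN gtr0_norm; lra.
have Iq : I (r + 2^-1 * e) by apply: in_I; rewrite gtr0_norm; lra.
(* These points are interior because they lie strictly between the points of [I] at distance [e / 2]
   on either side of [r]. *)
exists (r - 4^-1 * e), (r + 4^-1 * e); split; try lra.
  by apply: (interval_interior_between Ip Iq); lra.
by apply: (interval_interior_between Ip Iq); lra.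
Qed.

Lemma admissible_le r s : I r -> I s -> r <= s -> (F r <= F s)%E.
Proof.
case: F_adm => _ incF _ Ir Is; rewrite le_eqVlt => /orP[/eqP -> //|rs].
exact/ltW/incF.
Qed.

Lemma admissible_inj r s : I r -> I s -> F r = F s -> r = s.
Proof.
case: F_adm => _ incF _ Ir Is Frs.
have [rs|sr|//] := ltgtP r s.
  by have := incF _ _ Ir Is rs; rewrite Frs ltxx.
by have := incF _ _ Is Ir sr; rewrite Frs ltxx.
Qed.

(** An interior point has points of [I] to its left, so strict monotonicity keeps its value above
    [-oo]. *)
Lemma admissible_fin_num (r : R) : I° r -> F r \is a fin_num.
Proof.
move=> Ir; case: F_adm => Fy incF _.
have [p [_ [/interior_subset Ip _ /andP[pr _]]]] := interior_between Ir.
have Ir' := interior_subset Ir.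
rewrite fin_numE Fy// andbT.
by rewrite gt_eqF// (le_lt_trans (leNye _) (incF _ _ Ip Ir' pr)).
Qed.

(** All of [[p, q]] is interior to [I], so [F] is finite and continuous there and the real
    intermediate value theorem applies to [fine \o F]. *)
Lemma admissible_IVT (p q v : R) : I° p -> I° q -> p <= q ->
  (F p <= v%:E <= F q)%E -> exists2 r, I r & F r = v%:E.
Proof.
move=> Ip Iq pq /andP[Fpv vFq]; case: (F_adm) => _ _ contF.
have pqI (r : R) : p <= r <= q -> I° r.
  have [p' [_ [/interior_subset Ip' _ /andP[pp' _]]]] := interior_between Ip.
  have [_ [q' [_ /interior_subset Iq' /andP[_ qq']]]] := interior_between Iq.
  by move=> prq; apply: (interval_interior_between Ip' Iq'); lra.
have fpv : fine (F p) <= v by rewrite -lee_fin fineK ?admissible_fin_num.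
have vfq : v <= fine (F q) by rewrite -lee_fin fineK ?admissible_fin_num.
have [r] : exists2 r, r \in `[p, q] & (fine \o F) r = v.
  apply: IVT => //.
    apply: continuous_in_subspaceT => r /set_mem rpq.
    have prq : p <= r <= q by move: rpq; rewrite /= in_itv.
    have Fr : F x @[x --> r] --> (fine (F r))%:E.
      rewrite fineK; last exact: admissible_fin_num (pqI _ prq).
      exact: contF (pqI _ prq).
    exact: fine_cvg Fr.
  by rewrite /= ge_min le_max fpv vfq orbT.
rewrite in_itv /= => prq Frv; exists r; first exact: interior_subset (pqI _ prq).
by rewrite -Frv fineK//; exact: admissible_fin_num (pqI _ prq).
Qed.

(** * F-concave functions: constructions and rigidity *)

Context {N : nat}.
Implicit Types (Omega : set 'rV[R]_N) (f : 'rV[R]_N -> R).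

Lemma constant_F_concave Omega f : convex_set Omega ->
  range_in Omega I f -> constant_on Omega f -> F_concave Omega I F f.
Proof.
move=> cO If [c fc]; split=> // x y mu Ox Oy /[dup] mu01 /andP[mu0 mu1].
rewrite !fc//; last exact: convex_setP.
have Ic : I c by rewrite -(fc _ Ox); exact: If.
case: F_adm => /(_ _ Ic) Fc _ _.
(* [F c] may be [-oo]; distributivity holds because both weights are nonnegative. *)
rewrite -ge0_muleDl ?lee_fin ?subr_ge0// -EFinD subrK mul1e//.
Qed.

Lemma F_concave_lift Omega (g : 'rV[R]_N -> R) : convex_set Omega ->
  concave_on Omega g ->
  (forall x, Omega x -> exists2 r, I r & F r = (g x)%:E) ->
  exists2 f, F_concave Omega I F f & forall x, Omega x -> F (f x) = (g x)%:E.
Proof.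
move=> cO cg exr.
(* This is [F^-1] composed with [g]; the default 0 can occur only outside [Omega]. *)
pose f x := xget 0 [set r | I r /\ F r = (g x)%:E].
have fP x : Omega x -> I (f x) /\ F (f x) = (g x)%:E.
  by move=> /exr[r Ir Fr]; rewrite /f; case: xgetP => [//|/(_ r)]; case.
exists f => [|x /fP[]//]; split=> [x /fP[]//|x y mu Ox Oy mu01].
have [_ ->] := fP _ Ox; have [_ ->] := fP _ Oy.
have [_ ->] := fP _ (convex_setP cO Ox Oy mu01).
by rewrite -!EFinM -EFinD lee_fin; exact: cg.
Qed.

Lemma nontrivial_of_F_concave Omega f x y : F_concave Omega I F f ->
  Omega x -> Omega y -> F (f x) <> F (f y) ->
  F_concavity_nontrivial Omega I F.
Proof.
move=> fconc Ox Oy Fxy triv; move: fconc; rewrite triv => -[_ [c fc]].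
by apply: Fxy; rewrite !fc.
Qed.

Lemma F_concavity_nontrivial_proper Omega : I° !=set0 ->
  convex_domain Omega -> Omega <> setT -> F_concavity_nontrivial Omega I F.
Proof.
case=> r Ir [neO oO cO] OT.
have [p [q [Ip Iq /andP[pr rq]]]] := interior_between Ir.
have pq := lt_trans pr rq.
have Fp := admissible_fin_num Ip; have Fq := admissible_fin_num Iq.
have Fpq : fine (F p) < fine (F q).
  rewrite fine_lt//; case: F_adm => _ incF _.
  exact: incF (interior_subset Ip) (interior_subset Iq) pq.
have [x [y [Ox Oy dxy]]] := inradius_nonconstant neO oO OT.
pose d := inradius Omega; have dy0 : 0 < d y by exact: inradius_gt0.
(* With this slope, [g] below takes values between [F p] and [F q], reaches [F q] at [y], and is
   smaller at [x] since [d x < d y]. *)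
pose b := (fine (F q) - fine (F p)) / d y.
have b0 : 0 < b by rewrite divr_gt0// subr_gt0.
have bdy : b * d y = fine (F q) - fine (F p) by rewrite divfK// gt_eqF.
pose g z := fine (F p) + b * Num.min (d z) (d y).
have [|z Oz|f fconc Ff] := @F_concave_lift Omega g cO.
- exact: concave_on_min_affine (ltW b0) (inradius_concave OT cO).
- apply: (admissible_IVT Ip Iq (ltW pq)).
  rewrite -(fineK Fp) -(fineK Fq) !lee_fin.
  have dz0 : 0 <= Num.min (d z) (d y) by rewrite le_min inradius_ge0//= ltW.
  have dzy : Num.min (d z) (d y) <= d y by rewrite ge_min lexx orbT.
  have := mulr_ge0 (ltW b0) dz0; have := ler_wpM2l (ltW b0) dzy.
  by rewrite bdy /g; move: (b * _) => c; lra.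
apply: (nontrivial_of_F_concave fconc Ox Oy); rewrite !Ff// => -[].
apply/eqP; rewrite lt_eqF// /g minxx (min_idPl (ltW dxy)) ltrD2l.
by rewrite ltr_pM2l.
Qed.

(** Otherwise [F \o f] is real-valued, concave and bounded below on the whole space, hence constant,
    and injectivity of [F] on [I] makes [f] constant. *)
Lemma F_concave_nonconstant_inf f : F_concave setT I F f ->
  ~ constant_on setT f -> ereal_inf [set F (f x) | x in setT] = -oo%E.
Proof.
move=> [If fconc] ncf; apply: contrapT => infN.
have /eqP/= infNy := infN; rewrite -ltNye in infNy.
have lb x : (ereal_inf [set F (f x) | x in setT] <= F (f x))%E.
  by apply: ereal_inf_lbound; exists x.
have Ffin x : F (f x) \is a fin_num.
  case: F_adm => Fy _ _; rewrite fin_numE Fy ?andbT; last exact: If.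
  by rewrite -ltNye (lt_le_trans infNy).
have inf_fin : ereal_inf [set F (f x) | x in setT] \is a fin_num.
  by rewrite fin_numE -ltNye infNy /= -ltey (le_lt_trans (lb 0)) // ltey_eq Ffin.
pose g x := fine (F (f x)).
have cg : concave_on setT g.
  move=> x y mu _ _ mu01; rewrite -lee_fin EFinD !EFinM !fineK//.
  exact: fconc.
have gle : forall x y, g x <= g y.
  pose m := fine (ereal_inf [set F (f x) | x in setT]).
  apply: (@bounded_below_concave_constant _ _ g m cg) => x.
  by rewrite -lee_fin !fineK.
apply: ncf; exists (f 0) => x _; apply: admissible_inj; try exact: If.
rewrite -[LHS]fineK// -[RHS]fineK//; congr EFin.
by apply/eqP; rewrite eq_le !gle.
Qed.

Lemma F_concavity_nontrivial_of_infNy : (0 < N)%N -> I° !=set0 ->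
  ereal_inf (F @` I) = -oo%E -> F_concavity_nontrivial [set: 'rV[R]_N] I F.
Proof.
move=> N0 [q Iq] infN; case: (F_adm) => Fy incF _.
have Iq' := interior_subset Iq; have Fq := admissible_fin_num Iq.
pose e : 'rV[R]_N := const_mx 1.
have e0 : e <> 0.
  move/rowP/(_ (Ordinal N0)); rewrite !mxE; apply/eqP; exact: oner_neq0.
have cT : convex_set [set: 'rV[R]_N] by move=> x y l _ _; rewrite in_setT.
have [[a Ia Fa]|noNy] := pselect (exists2 a, I a & F a = -oo%E).
  (* For [0 < mu < 1] the weighted sum is [-oo] unless both points are the origin, and then their
     combination is the origin too. *)
  pose f (x : 'rV[R]_N) := if x == 0 then q else a.
  apply: (@nontrivial_of_F_concave _ f 0 e) => //; last first.
    rewrite /f eqxx; case: eqP => // _; rewrite Fa => Fqa.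
    by rewrite Fqa in Fq.
  split=> [x _|x y mu _ _ /andP[mu0 mu1]]; first by rewrite /f; case: ifP.
  have [->|mu_neq0] := eqVneq mu 0.
    by rewrite subr0 scale1r scale0r addr0 mul1e mul0e adde0.
  have [->|mu_neq1] := eqVneq mu 1.
    by rewrite subrr scale1r scale0r add0r mul1e mul0e add0e.
  have mup : (0 < mu%:E)%E by rewrite lte_fin lt_def mu_neq0.
  have mup' : (0 < (1 - mu)%:E)%E.
    by rewrite lte_fin subr_gt0 lt_def eq_sym mu_neq1.
  rewrite {1 2}/f; case: (eqVneq x 0) => [->|_]; last first.
    by rewrite Fa gt0_muleNy// addNye leNye.
  case: (eqVneq y 0) => [->|_]; last by rewrite Fa gt0_muleNy// addeNy leNye.
  rewrite !scaler0 addr0 /f eqxx -(ge0_muleDl _ (ltW mup') (ltW mup)).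
  by rewrite -EFinD subrK mul1e.
pose g (x : 'rV[R]_N) := fine (F q) - `|x|.
have [|x _|f fconc Ff] := @F_concave_lift setT g cT.
- exact: concave_on_opp_norm.
- have [_ [p Ip <-] Fpg] := lb_ereal_infNy_adherent (g x) infN.
  have Fp_fin : F p \is a fin_num.
    rewrite fin_numE Fy// andbT; apply/eqP => FpN; apply: noNy; by exists p.
  have gxq : ((g x)%:E <= F q)%E.
    by rewrite -(fineK Fq) lee_fin gerBl.
  have pq : p < q.
    rewrite ltNge; apply/negP => /(admissible_le Iq' Ip) /(le_trans gxq).
    by rewrite leNgt Fpg.
  (* The intermediate value argument needs [p] interior; a point [p'] of [I] to its left ensures
     this. *)
  have [_ [p' Ip' <-]] := lb_ereal_infNy_adherent (fine (F p)) infN.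
  rewrite fineK// => Fp'p.
  have p'p : p' < p.
    by rewrite ltNge; apply/negP => /(admissible_le Ip Ip'); rewrite leNgt Fp'p.
  apply: (@admissible_IVT p q) => //; last by rewrite ltW.
    by apply: (interval_interior_between Ip' Iq'); rewrite p'p.
  exact: ltW.
apply: (@nontrivial_of_F_concave _ f 0 e) => //; rewrite !Ff// /g normr0 => -[].
apply/eqP; rewrite subr0 gt_eqF// gtrBl normr_gt0; exact/eqP.
Qed.

End AdmissibleFunctions.

(** * Triviality of F-concavity on proper domains and on the whole space *)

Theorem theorem1p1 (R : realType) (N : nat) (N_ge1 : (1 <= N)%N)
    (I : set R) (I_interval : is_interval I) (I_int : I° !=set0)
    (F : R -> \bar R) (F_adm : admissible I F) :
  (forall Omega : set 'rV[R]_N,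
     convex_domain Omega -> Omega <> [set: 'rV[R]_N] ->
     F_concavity_nontrivial Omega I F)
  /\
  ((F_concavity_trivial [set: 'rV[R]_N] I F <->
      (-oo < ereal_inf (F @` I))%E)
   /\
   (F_concavity_nontrivial [set: 'rV[R]_N] I F ->
    forall f : 'rV[R]_N -> R,
      F_concave [set: 'rV[R]_N] I F f ->
      ~ constant_on [set: 'rV[R]_N] f ->
      ereal_inf [set F (f x) | x in [set: 'rV[R]_N]] = -oo%E)).
Proof.
split; first by move=> Omega; exact: F_concavity_nontrivial_proper.
split; last by move=> _ f; exact: F_concave_nonconstant_inf.
split=> [triv|infF].
  rewrite ltNye; apply/eqP => infN.
  exact: (F_concavity_nontrivial_of_infNy I_interval F_adm N_ge1 I_int infN).
apply/seteqP; split=> f.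
  move=> fconc; split; first by case: fconc.
  (* The values of [f] lie in [I], so the infimum of [F \o f] is at least that of [F] over [I],
     which exceeds [-oo]. *)
  apply: contrapT => ncf; have := F_concave_nonconstant_inf F_adm fconc ncf.
  apply/eqP; rewrite -ltNye; apply: (lt_le_trans infF).
  apply/ereal_infP => _ [x _ <-]; apply: ereal_inf_lbound.
  by exists (f x) => //; case: fconc => If _; exact: If.
by case=> If cf; apply: constant_F_concave => // x y l _ _; rewrite in_setT.
Qed.
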